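(* Let $\lambda$ be a partition with at most $n$ parts. Then \[ G_\lambda(x_1,\dots,x_n;\boldsymbol\alpha,\boldsymbol\beta)=\sum_{\mu\supseteq\lambda}C_{\lambda,\mu}(\boldsymbol\alpha,\boldsymbol\beta)s_\mu(x_1,\dots,x_n),\qquad g_\lambda(x_1,\dots,x_n;\boldsymbol\alpha,\boldsymbol\beta)=\sum_{\mu\subseteq\lambda}c_{\lambda,\mu}(\boldsymbol\alpha,\boldsymbol\beta)s_\mu(x_1,\dots,x_n), \] where $\mu$ ranges over partitions with at most $n$ parts.
   Context: $A_k=\alpha_1+\dots+\alpha_k$, $B_k=\beta_1+\dots+\beta_k$ for $k\ge1$, $A_k=B_k=0$ for $k\le0$. For a formal $\mathbb Z$-linear combination $Z=\sum_uc_uu$ of variables/parameters, $\sum_{m\ge0}h_m[Z]t^m=\prod_u(1-ut)^{-c_u}$, $h_m[Z]=0$ for $m<0$. For $\lambda$ with at most $n$ parts, $G_\lambda(x_1,\dots,x_n;\boldsymbol\alpha,\boldsymbol\beta)=\det\big(x_j^{\lambda_i+n-i}\prod_{k=1}^{i-1}(1-\beta_kx_j)/\prod_{k=1}^{\lambda_i}(1-\alpha_kx_j)\big)_{i,j=1}^n/\prod_{i<j}(x_i-x_j)$ and $g_\lambda(x_1,\dots,x_n;\boldsymbol\alpha,\boldsymbol\beta)=\det(h_{\lambda_i+n-i}[x_j-A_{\lambda_i-1}+B_{i-1}])_{i,j=1}^n/\prod_{i<j}(x_i-x_j)$. For $\lambda,\mu$ with at most $n$ parts, $C_{\lambda,\mu}(\boldsymbol\alpha,\boldsymbol\beta)=\det(h_{\mu_i-\lambda_j-i+j}[A_{\lambda_j}-B_{j-1}])_{i,j=1}^n$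 and $c_{\lambda,\mu}(\boldsymbol\alpha,\boldsymbol\beta)=\det(h_{\lambda_i-\mu_j-i+j}[-A_{\lambda_i-1}+B_{i-1}])_{i,j=1}^n$. $s_\mu(x_1,\dots,x_n)$ is the Schur polynomial. *)

(* Defs.v *)
From HB Require Import structures.
From mathcomp Require Import all_boot all_order all_algebra.
From mathcomp Require Import boolp classical_sets cardinality fsbigop.
From mathcomp Require Import mpoly freeg.

Set Implicit Arguments.
Unset Strict Implicit.
Unset Printing Implicit Defensive.

Import GRing.Theory.

Local Open Scope ring_scope.

(* R[[x_1, ..., x_n]]: a series is its family of coefficients. *)
Record mps (n : nat) (R : Type) := MPS { mps_coef :> 'X_{1..n} -> R }.

HB.instance Definition _ (n : nat) (R : Type) := gen_eqMixin (mps n R).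
HB.instance Definition _ (n : nat) (R : Type) := gen_choiceMixin (mps n R).

Lemma mpsP (n : nat) (R : Type) (F G : mps n R) : F =1 G -> F = G.
Proof. by case: F G => [F] [G] /= /funext ->. Qed.

Section MpsRing.
Variables (n : nat) (R : comNzRingType).
Implicit Types F G H : mps n R.

Definition mps_zero : mps n R := MPS (fun=> 0).
Definition mps_opp F : mps n R := MPS (fun m => - F m).
Definition mps_add F G : mps n R := MPS (fun m => F m + G m).
Definition mpsC (c : R) : mps n R := MPS (fun m => if m == 0%MM then c else 0).

(* Cauchy product: the bound on the multidegrees only makes the index type
   finite. *)
Definition mps_mul F G : mps n R := MPS (fun m =>
  \sum_(k : 'X_{1..n < (mdeg m).+1, (mdeg m).+1} | m == (k.1 + k.2)%MM)
     F k.1 * G k.2).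

Fact mps_addA : associative mps_add.
Proof. by move=> F G H; apply: mpsP => m /=; rewrite addrA. Qed.
Fact mps_addC : commutative mps_add.
Proof. by move=> F G; apply: mpsP => m /=; rewrite addrC. Qed.
Fact mps_add0 : left_id mps_zero mps_add.
Proof. by move=> F; apply: mpsP => m /=; rewrite add0r. Qed.
Fact mps_addN : left_inverse mps_zero mps_opp mps_add.
Proof. by move=> F; apply: mpsP => m /=; rewrite addNr. Qed.

HB.instance Definition _ :=
  GRing.isZmodule.Build (mps n R) mps_addA mps_addC mps_add0 mps_addN.

Definition mps_trunc (d : nat) F : {mpoly R[n]} :=
  \sum_(m : 'X_{1..n < d}) F m *: 'X_[m].

Lemma mcoeff_trunc d F m : (mdeg m < d)%N -> (mps_trunc d F)@_m = F m.
Proof. exact: mcoeff_mpoly. Qed.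

Lemma mps_mul_mcoeff F G (p q : {mpoly R[n]}) m :
    (forall k, (mdeg k <= mdeg m)%N -> p@_k = F k) ->
    (forall k, (mdeg k <= mdeg m)%N -> q@_k = G k) ->
  mps_mul F G m = (p * q)@_m.
Proof.
move=> pF qG; rewrite mcoeffM /=; apply: eq_bigr => k _.
by rewrite pF ?qG // -ltnS bmdeg.
Qed.

Fact mps_mulA : associative mps_mul.
Proof.
move=> F G H; apply: mpsP => m; pose T := mps_trunc (mdeg m).+1.
have TE K k : (mdeg k <= mdeg m)%N -> (T K)@_k = K k.
  by move=> le_k; rewrite mcoeff_trunc.
have TM K L k : (mdeg k <= mdeg m)%N -> (T K * T L)@_k = mps_mul K L k.
  move=> le_k; rewrite (@mps_mul_mcoeff _ _ (T K) (T L)) // => j le_j;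
  by rewrite TE // (leq_trans le_j).
rewrite (mps_mul_mcoeff (TE F) (TM G H)) mulrA.
by rewrite -(mps_mul_mcoeff (TM F G) (TE H)).
Qed.

Fact mps_mulC : commutative mps_mul.
Proof.
move=> F G; apply: mpsP => m; pose T := mps_trunc (mdeg m).+1.
have TE K k : (mdeg k <= mdeg m)%N -> (T K)@_k = K k.
  by move=> le_k; rewrite mcoeff_trunc.
rewrite (mps_mul_mcoeff (TE F) (TE G)) mulrC.
by rewrite -(mps_mul_mcoeff (TE G) (TE F)).
Qed.

Fact mps_mul1 : left_id (mpsC 1) mps_mul.
Proof.
move=> F; apply: mpsP => m; pose T := mps_trunc (mdeg m).+1.
have TE K k : (mdeg k <= mdeg m)%N -> (T K)@_k = K k.
  by move=> le_k; rewrite mcoeff_trunc.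
have T1 k : (mdeg k <= mdeg m)%N -> (1 : {mpoly R[n]})@_k = mpsC 1 k.
  by move=> _ /=; rewrite mcoeff1; case: eqP.
by rewrite (mps_mul_mcoeff T1 (TE F)) mul1r TE.
Qed.

Fact mps_mulDl : left_distributive mps_mul mps_add.
Proof.
move=> F G H; apply: mpsP => m /=; rewrite -big_split /=.
by apply: eq_bigr => k _; rewrite mulrDl.
Qed.

Fact mps_one_neq0 : mpsC 1 != 0.
Proof.
apply/eqP => /(congr1 (fun F : mps n R => F 0%MM)) /=.
by rewrite eqxx => /eqP; rewrite oner_eq0.
Qed.

HB.instance Definition _ := GRing.Zmodule_isComNzRing.Build (mps n R)
  mps_mulA mps_mulC mps_mul1 mps_mulDl mps_one_neq0.

Definition mps_unit : pred (mps n R) := fun F => `[< exists G, G * F = 1 >].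
Definition mps_inv F : mps n R :=
  if pselect (exists G, G * F = 1) is left e then projT1 (cid e) else F.

Fact mps_mulV : {in mps_unit, left_inverse 1 mps_inv *%R}.
Proof.
move=> F /asboolP uF; rewrite /mps_inv; case: pselect => // e.
by case: cid.
Qed.
Fact mps_unitP F G : G * F = 1 -> mps_unit F.
Proof. by move=> GF; apply/asboolP; exists G. Qed.
Fact mps_inv_out : {in [predC mps_unit], mps_inv =1 id}.
Proof.
move=> F /asboolP nF; rewrite /mps_inv; case: pselect => // e.
Qed.

HB.instance Definition _ := GRing.ComNzRing_hasMulInverse.Build (mps n R)
  mps_mulV mps_unitP mps_inv_out.

Definition mpsX (j : 'I_n) : mps n R :=
  MPS (fun m => if m == U_(j)%MM then 1 else 0).

(* The family (F i)_(i in D) is summable in R[[x_1, ..., x_n]], with sum S: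
   at each monomial only finitely many terms contribute, and \sum_(i \in D)
   is the sum of these finitely many contributions. *)
Definition mps_has_sum (I : choiceType) (D : set I) (F : I -> mps n R)
    (S : mps n R) : Prop :=
  forall m : 'X_{1..n},
    finite_set (D `&` [set i | F i m != 0])%classic /\
    S m = \sum_(i \in D) F i m.

(* The quotient F / D of a series F by a regular, not necessarily invertible,
   series D dividing it (junk value 0 if D does not divide F); it is unique when
   D is regular, as the Vandermonde product is over any R. *)
Definition mps_exquot F D : mps n R := xget 0 [set Q | Q * D = F]%classic.

End MpsRing.

Section Plethysm.
Variable S : comNzRingType.

(* \prod_u (1 - u t)^(- c_u) as a series in the single variable t, where
   Z = \sum_u c_u << u >>. *)
Definition hgen (Z : {freeg S / int}) : mps 1 S :=
  \prod_(u <- dom Z) (1 - mpsC 1 u * mpsX S ord0) ^ (- coeff u Z).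

Definition hpl (Z : {freeg S / int}) (m : int) : S :=
  if m is Posz k then hgen Z (U_(ord0) *+ k)%MM else 0.

(* The formal sum a_1 + ... + a_k, which is 0 for k <= 0; a 0 is unused. *)
Definition psum (a : nat -> S) (k : int) : {freeg S / int} :=
  if k is Posz p then \sum_(1 <= i < p.+1) << (1 : int) *g a i >> else 0.

End Plethysm.

Record part (n : nat) := Part {
  part_tuple : n.-tuple nat;
  part_sorted : sorted geq part_tuple
}.

HB.instance Definition _ (n : nat) := [isSub for @part_tuple n].
HB.instance Definition _ (n : nat) := [Countable of part n by <:].

(* Indices start at 0: la i is the part usually written lambda_(i+1). *)
Definition part_nth (n : nat) (la : part n) (i : 'I_n) : nat :=
  tnth (part_tuple la) i.
Coercion part_nth : part >-> Funclass.

Definition part_sub (n : nat) (mu la : part n) : Prop :=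
  forall i : 'I_n, (mu i <= la i)%N.

(* Rows and columns are numbered from 0, so the indices i and j of the usual
   formulas are i.+1 and j.+1 here. *)

Section Grothendieck.
Variables (n : nat) (R : comNzRingType).

Definition vandermonde : mps n R :=
  \prod_(i < n) \prod_(j < n | (i < j)%N) (mpsX R i - mpsX R j).

Definition schur (mu : part n) : mps n R :=
  mps_exquot (\det (\matrix_(i < n, j < n) mpsX R j ^+ (mu i + (n - i.+1))))
             vandermonde.

Definition bigG (alpha beta : nat -> R) (la : part n) : mps n R :=
  mps_exquot
    (\det (\matrix_(i < n, j < n)
       (mpsX R j ^+ (la i + (n - i.+1))
        * (\prod_(1 <= k < i.+1) (1 - mpsC n (beta k) * mpsX R j))
        / (\prod_(1 <= k < (la i).+1) (1 - mpsC n (alpha k) * mpsX R j)))))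
    vandermonde.

Definition smallg (alpha beta : nat -> R) (la : part n) : mps n R :=
  mps_exquot
    (\det (\matrix_(i < n, j < n)
       hpl (<< (1 : int) *g mpsX R j >>
            - psum (fun k => mpsC n (alpha k)) ((la i)%:Z - 1)
            + psum (fun k => mpsC n (beta k)) i%:Z)
           (la i + (n - i.+1))%N%:Z))
    vandermonde.

Definition bigC (alpha beta : nat -> R) (la mu : part n) : R :=
  \det (\matrix_(i < n, j < n)
     hpl (psum alpha (la j)%:Z - psum beta j%:Z)
         ((mu i)%:Z - (la j)%:Z - i%:Z + j%:Z)).

Definition smallc (alpha beta : nat -> R) (la mu : part n) : R :=
  \det (\matrix_(i < n, j < n)
     hpl (- psum alpha ((la i)%:Z - 1) + psum beta i%:Z)
         ((la i)%:Z - (mu j)%:Z - i%:Z + j%:Z)).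

End Grothendieck.

(* Main.v *)
(* The quotient of an alternant by the Vandermonde product is compatible with
   sums, so it suffices to expand the two numerators. Row i of either one is a
   combination of the powers x_j^l with coefficients a(i, l) independent of j:
   for G these are the h_(l - lambda_i - n + i)[A - B], read off the generating
   function at t = x_j; for g they come from splitting off 1/(1 - x_j t). The
   Cauchy-Binet formula turns the numerator into a sum over mu of a minor of a
   times the alternant of mu, and that minor is C or c. It has a zero block when
   mu violates the containment. For G the rows are infinite, and are truncated
   degree by degree: s_mu does not contribute in low degree when mu is large. *)
From HB Require Import structures.
Require Import Defs.
From mathcomp Require Import all_boot all_order all_algebra all_fingroup.
From mathcomp Require Import boolp classical_sets cardinality fsbigop.
From mathcomp Require Import mpoly freeg zify.

Set Implicit Arguments.
Unset Strict Implicit.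
Unset Printing Implicit Defensive.

Import GRing.Theory.
Local Open Scope ring_scope.

(** * Multivariate power series *)

Section PowerSeries.
Variables (n : nat) (R : comNzRingType).
Implicit Types (F G : mps n R) (m : 'X_{1..n}).

Lemma mpsD F G m : (F + G) m = F m + G m.
Proof. by []. Qed.

Lemma mpsN F m : (- F) m = - F m.
Proof. by []. Qed.

Lemma mps0 m : (0 : mps n R) m = 0.
Proof. by []. Qed.

Lemma mps1 m : (1 : mps n R) m = (m == 0%MM)%:R.
Proof. by rewrite [LHS]/=; case: eqP. Qed.

Lemma mps_sum (I : Type) (r : seq I) (P : pred I) (F : I -> mps n R) m :
  (\sum_(i <- r | P i) F i) m = \sum_(i <- r | P i) F i m.
Proof. by elim/big_rec2: _ => // i y x _ <-. Qed.

Lemma mpsMC F c m : (F * mpsC n c) m = F m * c.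
Proof.
rewrite [LHS](@mps_mul_mcoeff _ _ _ _ (mps_trunc (mdeg m).+1 F) c%:MP).
- by rewrite mulrC mcoeffCM mcoeff_trunc // mulrC.
- by move=> k le_k; rewrite mcoeff_trunc.
- by move=> k _; rewrite mcoeffC /=; case: eqP => _; rewrite ?mulr1 ?mulr0.
Qed.

Lemma mpsCM c F m : (mpsC n c * F) m = c * F m.
Proof. by rewrite mulrC mpsMC mulrC. Qed.

Fact mpsC_zmod_morphism : zmod_morphism (@mpsC n R).
Proof. by move=> a b; apply: mpsP => m /=; case: ifP; rewrite ?subr0. Qed.

Fact mpsC_monoid_morphism : monoid_morphism (@mpsC n R).
Proof.
split=> // a b; apply: mpsP => m; rewrite mpsCM /=.
by case: ifP; rewrite ?mulr0.
Qed.

HB.instance Definition _ :=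
  GRing.isZmodMorphism.Build R (mps n R) (@mpsC n R) mpsC_zmod_morphism.
HB.instance Definition _ :=
  GRing.isMonoidMorphism.Build R (mps n R) (@mpsC n R) mpsC_monoid_morphism.

(** The case [m j = 0] is separate because subtraction of multi-indices truncates at 0. *)
Lemma mpsMX F j m :
  (F * mpsX R j) m = if m j is 0 then 0 else F (m - U_(j))%MM.
Proof.
rewrite [LHS](@mps_mul_mcoeff _ _ _ _ (mps_trunc (mdeg m).+1 F) 'X_j).
- case mj: (m j) => [|p].
    rewrite mcoeffM big1 // => k /eqP mE; rewrite mcoeffX.
    have [kE|_] := eqVneq; last by rewrite mulr0.
    move/(congr1 (fun m' : 'X_{1..n} => m' j)): mE.
    by rewrite mnmDE -kE mnm1E eqxx addn1 mj.
  have le_m : (U_(j) <= m)%MM by rewrite lep1mP mj.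
  have -> (q : {mpoly R[n]}) : (q * 'X_j)@_m = q@_(m - U_(j)).
    by rewrite -{1}(submK le_m) addmC mcoeffMX.
  by rewrite mcoeff_trunc // ltnS mdegB.
- by move=> k le_k; rewrite mcoeff_trunc.
- by move=> k _; rewrite mcoeffX /= [k == _]eq_sym; case: eqP.
Qed.

Lemma mpsMX_add F j m : (F * mpsX R j) (m + U_(j))%MM = F m.
Proof. by rewrite mpsMX mnmDE mnm1E eqxx addn1 addmK. Qed.

Lemma mpsXn j k m : (mpsX R j ^+ k) m = (m == U_(j) *+ k)%MM%:R.
Proof.
elim: k m => [|k IHk] m; first by rewrite expr0 mps1.
rewrite exprSr mpsMX; case mj: (m j) => [|p].
  case: eqP => // mE; move: mj.
  by rewrite mE mulmnE mnm1E eqxx mul1n.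
have le_m : (U_(j) <= m)%MM by rewrite lep1mP mj.
rewrite IHk; congr (_ : bool)%:R.
by rewrite mulmSr -{2}(submK le_m) (can_eq (addmK _)).
Qed.


(** If H x_i = H x_j, the coefficient of H is unchanged when one unit of exponent moves from x_j to
    x_i, and it is 0 once x_j has exponent 0. Induction on that exponent gives H = 0 over any
    [R]. *)
Lemma lreg_mpsXB (i j : 'I_n) : i != j -> GRing.lreg (mpsX R i - mpsX R j).
Proof.
move=> ne_ij F G /eqP; rewrite -subr_eq0 -mulrBr mulrBl subr_eq0.
set H := F - G => /eqP HE; apply/eqP; rewrite -subr_eq0 -/H; apply/eqP.
apply: mpsP => m; rewrite mps0; move mj: (m j) => k.
elim: k m mj => [|k IHk] m mj.
  rewrite -(mpsMX_add H i) [H * _]mulrC HE mulrC mpsMX.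
  by rewrite mnmDE mj mnm1E (negbTE ne_ij).
rewrite -(mpsMX_add H i) [H * _]mulrC HE mulrC mpsMX.
rewrite mnmDE mj mnm1E (negbTE ne_ij) addn0 IHk //.
by rewrite mnmBE mnmDE mj !mnm1E eqxx (negbTE ne_ij) addn0 subn1.
Qed.

Lemma lreg_vandermonde : GRing.lreg (vandermonde n R).
Proof.
apply: big_ind => [||i _]; [exact: lreg1 | exact: lregM |].
apply: big_ind => [||j lt_ij]; [exact: lreg1 | exact: lregM |].
by apply: lreg_mpsXB; apply: contraTneq lt_ij => ->; rewrite ltnn.
Qed.

Lemma mps_exquotP (Q D : mps n R) :
  GRing.lreg D -> mps_exquot (Q * D) D = Q.
Proof.
move=> regD; apply: xget_unique => [|Q' /=]; first by [].
by rewrite ![_ * D]mulrC => /regD.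
Qed.

Definition mps_homog (d : nat) F := forall m, F m != 0 -> mdeg m = d.

Lemma mps_homog0 d : mps_homog d 0.
Proof. by move=> m; rewrite mps0 eqxx. Qed.

Lemma mps_homogD d F G : mps_homog d F -> mps_homog d G -> mps_homog d (F + G).
Proof.
move=> hF hG m; rewrite mpsD; have [->|/hF //] := eqVneq (F m) 0.
by rewrite add0r; apply: hG.
Qed.

Lemma mps_homogN d F : mps_homog d F -> mps_homog d (- F).
Proof. by move=> hF m; rewrite mpsN oppr_eq0; apply: hF. Qed.

Lemma mps_homogM d e F G :
  mps_homog d F -> mps_homog e G -> mps_homog (d + e) (F * G).
Proof.
move=> hF hG m; apply: contraNeq => ne_m; apply/eqP; rewrite [LHS]/=.
rewrite big1 // => k /eqP mE.
have [->|/hF dF] := eqVneq (F k.1) 0; first by rewrite mul0r.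
have [->|/hG dG] := eqVneq (G k.2) 0; first by rewrite mulr0.
by case/eqP: ne_m; rewrite [in LHS]mE mdegD dF dG.
Qed.

Lemma mps_homog1 : mps_homog 0 1.
Proof.
by move=> m; rewrite mps1; case: (m =P 0%MM) => [->|_]; rewrite ?mdeg0 /= ?eqxx.
Qed.

Lemma mps_homogX j k : mps_homog k (mpsX R j ^+ k).
Proof.
move=> m; rewrite mpsXn; case: (m =P _) => [-> _|]; last by rewrite eqxx.
by rewrite mdegMn mdeg1 mul1n.
Qed.

Lemma mps_homog_vandermonde : exists e, mps_homog e (vandermonde n R).
Proof.
apply: (big_ind (fun F => exists e, mps_homog e F)) => [|F G [d hF] [e hG]|i _].
- by exists 0%N; apply: mps_homog1.
- by exists (d + e)%N; apply: mps_homogM.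
apply: (big_ind (fun F => exists e, mps_homog e F)) => [|F G [d hF] [e hG]|j _].
- by exists 0%N; apply: mps_homog1.
- by exists (d + e)%N; apply: mps_homogM.
exists 1%N; rewrite -[mpsX R i]expr1 -[mpsX R j]expr1.
by apply: mps_homogD; [|apply: mps_homogN]; apply: mps_homogX.
Qed.

(** The component [F'] of [F] in degree [mdeg m] yields the component of [F * G] in degree
    [mdeg m + e]. If that degree is not [d], this component is 0, and regularity of [G] forces
    [F' = 0]. *)
Lemma mps_homog_quot d e F G m :
  GRing.lreg G -> mps_homog e G -> mps_homog d (F * G) -> F m != 0 ->
  (mdeg m + e)%N = d.
Proof.
move=> regG hG hFG; apply: contraNeq => ne_d.
pose F' : mps n R := MPS (fun k => if mdeg k == mdeg m then F k else 0).
suff F'0 : F' = 0 by rewrite -(mps0 m) -F'0 /= eqxx.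
apply: regG; rewrite mulr0 mulrC; apply: mpsP => k; rewrite mps0.
have [kE|kN] := eqVneq (mdeg k) (mdeg m + e)%N.
  have <- : (F * G) k = 0.
    by apply/eqP; apply: contraNT ne_d => /hFG <-; rewrite kE.
  apply: eq_bigr => l /eqP lE /=; case: eqP => // ne_l.
  have [->|/hG eG] := eqVneq (G l.2) 0; first by rewrite !mulr0.
  case: ne_l; apply: (@addIn e); rewrite -[RHS]kE [in RHS]lE mdegD.
  by rewrite [in RHS]eG.
rewrite [LHS]/= big1 // => l /eqP lE /=;
case: eqP => [dl|]; last by rewrite mul0r.
have [->|/hG eG] := eqVneq (G l.2) 0; first by rewrite mulr0.
by case/eqP: kN; rewrite [in LHS]lE mdegD eG dl.
Qed.

(** Congruence modulo the monomials of degree above [d]. It passes to determinants, which allows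
    infinite rows to be replaced by finite ones. *)
Definition eqdeg d F G := forall m, (mdeg m <= d)%N -> F m = G m.

Lemma eqdegM d F F' G G' :
  eqdeg d F F' -> eqdeg d G G' -> eqdeg d (F * G) (F' * G').
Proof.
move=> eF eG m le_m; apply: eq_bigr => k _.
by congr (_ * _); [apply: eF | apply: eG];
  apply: leq_trans le_m; rewrite -ltnS bmdeg.
Qed.

Lemma eqdeg_det d p (A B : 'M[mps n R]_p) :
  (forall i j, eqdeg d (A i j) (B i j)) -> eqdeg d (\det A) (\det B).
Proof.
move=> eAB; rewrite /determinant.
apply: big_ind2 => // [F G H K eFG eHK m le_m|s _].
  by rewrite !mpsD eFG ?eHK.
apply: eqdegM => //; apply: big_ind2 => // F G H K; exact: eqdegM.
Qed.

End PowerSeries.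

(** * Alternants and the Cauchy-Binet formula *)

Section Determinants.
Variable S : comNzRingType.

(* Reducing 'X^l modulo the monic \prod_k ('X - x_k) expresses x_j^l as a
   combination, independent of j, of 1, x_j, ..., x_j^(n - 1). *)
Lemma alternant_quotient n (x : 'I_n -> S) (l : 'I_n -> nat) :
  exists q, \det (\matrix_(i, j) x j ^+ l i) =
    q * \prod_(i < n) \prod_(j < n | (i < j)%N) (x i - x j).
Proof.
pose P := \prod_(k < n) ('X - (x k)%:P).
have monP : P \is monic by apply: monic_prod_XsubC.
have szP : size P = n.+1.
  by rewrite /P size_prod_XsubC /index_enum -enumT size_enum_ord.
pose r i := Pdiv.CommonRing.rmodp 'X^(l i) P.
have -> : \matrix_(i, j) x j ^+ l i =
    \matrix_(i, k) (r i)`_k *m Vandermonde n (\row_j x j).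
  apply/matrixP => i j; rewrite !mxE.
  under eq_bigr do rewrite !mxE.
  rewrite -horner_coef_wide; last first.
    by rewrite -ltnS -szP Pdiv.CommonRing.ltn_rmodpN0 // monic_neq0.
  rewrite -[x j ^+ _]hornerXn.
  rewrite [X in X.[_]](Pdiv.RingMonic.rdivp_eq monP) -/(r i) hornerD.
  (* The multiple of [P] drops out because [P] vanishes at x_j. *)
  rewrite hornerM {2}/P horner_prod (bigD1 j) //= hornerXsubC subrr.
  by rewrite mul0r mulr0 add0r.
rewrite det_mulmx det_Vandermonde.
(* [det_Vandermonde] has the factors x_j - x_i for i < j, so each pair costs a sign. *)
exists (\det (\matrix_(i, k) (r i)`_k)
  * \prod_(i < n) \prod_(j < n | (i < j)%N) -1).
rewrite -mulrA -big_split; congr (_ * _); apply: eq_bigr => i _ /=.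
rewrite -big_split; apply: eq_bigr => j _ /=.
by rewrite !mxE mulN1r opprB.
Qed.

Section CauchyBinet.
Variables (n N : nat).
Implicit Types (f g : {ffun 'I_n -> 'I_N}) (s : 'S_n).

(** Each entry of the product is a sum over an inner index; distributivity turns the product over
    the rows into a sum over all choices [f] of one inner index per row. *)
Lemma det_mulmx_ffun (A : 'M[S]_(n, N)) (B : 'M[S]_(N, n)) :
  \det (A *m B) = \sum_(f : {ffun 'I_n -> 'I_N})
    (\prod_i A i (f i)) * \det (\matrix_(i, j) B (f i) j).
Proof.
rewrite /determinant.
under eq_bigr => s _.
  under eq_bigr do rewrite mxE.
  rewrite bigA_distr_bigA mulr_sumr; over.
rewrite exchange_big /=; apply: eq_bigr => f _.
rewrite mulr_sumr; apply: eq_bigr => s _.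
rewrite big_split /= mulrCA; congr (_ * (_ * _)).
by apply: eq_bigr => i _; rewrite mxE.
Qed.

(** Such [g] represent the subsets of size [n], listed in the order of the exponents of an
    alternant. *)
Definition decreasing_ffun : pred {ffun 'I_n -> 'I_N} :=
  fun g => [forall i : 'I_n, forall j : 'I_n, (i < j)%N ==> (g j < g i)%N].

Lemma decreasing_ffunE g (i j : 'I_n) :
  decreasing_ffun g -> (g j < g i)%N = (i < j)%N.
Proof.
move=> /forallP decg.
have decr (i' j' : 'I_n) : (i' < j')%N -> (g j' < g i')%N.
  by move=> lt_ij; have /forallP/(_ j')/implyP := decg i'; apply.
case: (ltngtP i j) => [/decr //|/decr|/val_inj ->]; last by rewrite ltnn.
by move=> /ltnW; rewrite leqNgt => /negbTE.
Qed.

(** For injective [f], the position of [f i], from 0, when the values are sorted decreasingly. *)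
Definition decreasing_rank f (i : 'I_n) : nat := #|[set k | (f i < f k)%N]|.

Lemma decreasing_rank_ltn f i : (decreasing_rank f i < n)%N.
Proof.
rewrite -[X in (_ < X)%N]card_ord -cardsT; apply: proper_card.
rewrite finset.properEneq finset.subsetT andbT.
apply/negP => /eqP/finset.setP/(_ i).
by rewrite !inE ltnn.
Qed.

Lemma decreasing_rank_lt f i j :
  (f j < f i)%N -> (decreasing_rank f i < decreasing_rank f j)%N.
Proof.
move=> lt_f; apply: proper_card; apply/fintype.properP; split.
  by apply/fintype.subsetP => k; rewrite !inE; apply: ltn_trans.
by exists i; rewrite !inE ?ltnn.
Qed.

Lemma decreasing_rankE f i j : injective f ->
  (decreasing_rank f i < decreasing_rank f j)%N = (f j < f i)%N.
Proof.
move=> injf; have [lt_f|le_f] := ltnP (f j) (f i).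
  exact: decreasing_rank_lt.
have [->|ne_ij] := eqVneq i j; first by rewrite ltnn.
apply/negbTE; rewrite -leqNgt ltnW // decreasing_rank_lt // ltn_neqAle le_f.
by rewrite andbT; apply: contra ne_ij => /eqP/val_inj/injf ->.
Qed.

Lemma rank_ord_inj f : injective f ->
  injective (fun i => Ordinal (decreasing_rank_ltn f i)).
Proof.
move=> injf i j [] rk_ij; apply: injf; apply: val_inj => /=.
case: (ltngtP (f i) (f j)) => // /decreasing_rank_lt.
  by rewrite rk_ij ltnn.
by rewrite rk_ij ltnn.
Qed.

(** The permutation that sorts [f]; the identity is a default for non-injective [f]. *)
Definition rank_perm f : 'S_n :=
  if injectiveP f is ReflectT injf then perm (rank_ord_inj injf) else 1%g.

Lemma rank_permE f i :
  injective f -> rank_perm f i = decreasing_rank f i :> nat.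
Proof.
by move=> injf; rewrite /rank_perm; case: injectiveP => // injf'; rewrite permE.
Qed.

(** A non-injective [f] repeats a row of [B] and contributes 0. An injective [f] is uniquely [g]
    after [s], with [g] decreasing and [s] a permutation; the sign of [s] comes out of the minor of
    [B], and the sum over [s] rebuilds the minor of [A]. *)
Lemma cauchy_binet (A : 'M[S]_(n, N)) (B : 'M[S]_(N, n)) :
  \det (A *m B) = \sum_(g | decreasing_ffun g)
    \det (\matrix_(i, j) A i (g j)) * \det (\matrix_(i, j) B (g i) j).
Proof.
rewrite det_mulmx_ffun (bigID (fun f => injectiveb f)) /=.
rewrite [X in _ + X]big1 ?addr0.
  pose h (p : {ffun 'I_n -> 'I_N} * 'S_n) := [ffun i => p.1 (p.2 i)].
  pose h' f := ([ffun i => f ((rank_perm f)^-1%g i)], rank_perm f).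
  under [RHS]eq_bigr => g _ do rewrite {1}/determinant mulr_suml.
  rewrite pair_big_dep /= (reindex_onto h h') /=.
    apply: eq_big => [[g s]|[g s] _] /=.
      apply/andP/idP; rewrite andbT.
        rewrite /h' => -[/injectiveP]; move: (h _) => f injf /eqP [<- _].
        apply/forallP => i; apply/forallP => j; apply/implyP => lt_ij.
        by rewrite !ffunE -decreasing_rankE // -!rank_permE // !permKV.
      move=> decg; have injg : injective g.
        move=> i j g_ij; apply: val_inj.
        have := decreasing_ffunE i j decg; have := decreasing_ffunE j i decg.
        by rewrite g_ij ltnn; case: ltngtP.
      have injh : injective (h (g, s)).
        by move=> i j; rewrite !ffunE => /injg/perm_inj.
      split; first exact/injectiveP.
      (* The values above g(s i) are the g(s k) with s k < s i, and there are s i of them. *)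
      have rk : rank_perm (h (g, s)) = s.
        apply/permP => i; apply: val_inj; rewrite /= rank_permE //.
        rewrite /decreasing_rank.
        have -> : [set k | (h (g, s) i < h (g, s) k)%N] =
                  s @^-1: [set k : 'I_n | (k < s i)%N].
          by apply/finset.setP => k; rewrite !inE !ffunE /= decreasing_ffunE.
        rewrite on_card_preimset; last first.
          by exists (s^-1)%g => k _; rewrite ?permK ?permKV.
        rewrite -sum1dep_card (big_ord_narrow (ltnW (ltn_ord (s i)))).
        by rewrite sum1_card card_ord.
      rewrite /h' rk; apply/eqP; congr (_, _); apply/ffunP => i.
      by rewrite !ffunE /= permKV.
    rewrite [RHS]mulrAC [RHS]mulrC; congr (_ * _).
      by apply: eq_bigr => i _; rewrite mxE ffunE.
    rewrite -det_perm -det_mulmx; congr (\det _); apply/matrixP => i j.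
    by rewrite -row_permE !mxE ffunE.
  move=> f /injectiveP injf; apply/ffunP => i; rewrite !ffunE /=.
  by rewrite permK.
move=> f /injectivePn [i [j ne_ij f_ij]].
rewrite (determinant_alternate ne_ij) ?mulr0 // => k.
by rewrite !mxE f_ij.
Qed.

End CauchyBinet.

(** The zero block has n - k rows and k + 1 columns, n + 1 in all. By the pigeonhole principle every
    permutation meets it, so every term of the expansion vanishes. *)
Lemma det_zero_block n (M : 'M[S]_n) (k : 'I_n) :
  (forall i j : 'I_n, (k <= i)%N -> (j <= k)%N -> M i j = 0) -> \det M = 0.
Proof.
move=> M0; rewrite /determinant big1 // => s _.
suff [i le_ki le_sk] : exists2 i : 'I_n, (k <= i)%N & (s i <= k)%N.
  by rewrite (bigD1 i) //= M0 // mul0r mulr0.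
pose L := [set i : 'I_n | (k <= i)%N].
have [/exists_inP [i iL le_s]|/exists_inPn noL] :=
    boolP [exists i in L, (s i <= k)%N].
  by exists i => //; rewrite inE in iL.
have : (#|s @: L| <= #|L :\ k|)%N.
  apply: subset_leq_card; apply/fintype.subsetP => _ /imsetP [i iL ->].
  have := noL i iL; rewrite -ltnNge !inE => lt_ks.
  by rewrite (ltnW lt_ks) andbT; apply: contraTneq lt_ks => ->; rewrite ltnn.
rewrite card_imset; last exact: perm_inj.
by rewrite [X in (X <= _)%N](cardsD1 k) inE leqnn ltnn.
Qed.

End Determinants.

(** * Generating functions *)

Section Univariate.
Variables (n : nat) (R : comNzRingType) (j : 'I_n).

(** The series \sum_p a_p x_j^p; the test recognises the powers of x_j. *)
Definition mps_uni (a : nat -> R) : mps n R :=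
  MPS (fun m => if m == (U_(j) *+ m j)%MM then a (m j) else 0).

Definition mps_lin (c : R) : mps n R := 1 - mpsC n c * mpsX R j.

Lemma eq_mps_uni a b : a =1 b -> mps_uni a = mps_uni b.
Proof. by move=> eq_ab; apply: mpsP => m /=; rewrite eq_ab. Qed.

Lemma mps_uniMX a :
  mps_uni a * mpsX R j = mps_uni (fun p => if p is q.+1 then a q else 0).
Proof.
apply: mpsP => m; rewrite mpsMX /=; case mj: (m j) => [|p]; first by case: ifP.
have le_m : (U_(j) <= m)%MM by rewrite lep1mP mj.
rewrite /= mnmBE mj mnm1E eqxx subn1 /= mulmSr -(can_eq (addmK U_(j))).
by rewrite submK.
Qed.

Lemma mps_uniMC a c : mps_uni a * mpsC n c = mps_uni (fun p => a p * c).
Proof.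
by apply: mpsP => m; rewrite mpsMC /=; case: ifP; rewrite ?mul0r.
Qed.

Lemma mps_uniB a b : mps_uni a - mps_uni b = mps_uni (fun p => a p - b p).
Proof. by apply: mpsP => m /=; case: ifP; rewrite ?subr0. Qed.

Lemma mps_uni1 : mps_uni (fun p => (p == 0)%:R) = 1.
Proof.
apply: mpsP => m; rewrite mps1 /=.
have [mE|mN] := eqVneq m (U_(j) *+ m j)%MM.
  have [->|nz_m] := eqVneq m 0%MM; first by rewrite mnm0E.
  case: (m j) mE => // mE; case/eqP: nz_m.
  by rewrite mE mulm0n.
by case: eqP => // mE; case/eqP: mN; rewrite mE mnm0E mulm0n.
Qed.

Lemma mps_uniM_lin a c : mps_uni a * mps_lin c =
  mps_uni (fun p => a p - if p is q.+1 then a q * c else 0).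
Proof.
rewrite mulrBr mulr1 mulrCA mps_uniMX mulrC mps_uniMC mps_uniB.
apply: eq_mps_uni => -[|p] //.
by rewrite mul0r.
Qed.

Lemma mps_lin_unit c : mps_lin c \is a GRing.unit.
Proof.
(* The inverse is the geometric series. *)
apply/unitrP; exists (mps_uni (fun p => c ^+ p)).
suff eq1 : mps_uni (fun p => c ^+ p) * mps_lin c = 1 by split; rewrite // mulrC.
rewrite mps_uniM_lin -mps_uni1.
apply: eq_mps_uni => -[|p]; first by rewrite subr0.
by rewrite exprSr subrr.
Qed.

(** Integer indices let the shift by [L] be written uniformly: the new low coefficients have a
    negative index and vanish. *)
Lemma mpsXn_uni (h : int -> R) L : (forall p, h (Negz p) = 0) ->
  mpsX R j ^+ L * mps_uni (fun p => h p) = mps_uni (fun p => h (p%:Z - L%:Z)).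
Proof.
move=> h0; elim: L => [|L IHL].
  by rewrite mul1r; apply: eq_mps_uni => p; rewrite subr0.
rewrite exprS -mulrA IHL mulrC mps_uniMX; apply: eq_mps_uni => -[|p].
  by rewrite sub0r -NegzE h0.
by congr (h _); rewrite !intS opprD addrACA subrr add0r.
Qed.

Lemma mps_uni_trunc a N d : (d < N)%N ->
  eqdeg d (mps_uni a) (\sum_(l < N) mpsC n (a l) * mpsX R j ^+ l).
Proof.
move=> lt_d m le_m; rewrite mps_sum.
under eq_bigr do rewrite mpsCM mpsXn.
rewrite [LHS]/=.
have [mE|mN] := eqVneq m (U_(j) *+ m j)%MM.
  have lt_mj : (m j < N)%N.
    apply: leq_ltn_trans lt_d; rewrite (leq_trans _ le_m) //.
    by rewrite mdegE (bigD1 j) //= leq_addr.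
  rewrite (bigD1 (Ordinal lt_mj)) //= -mE eqxx mulr1 big1 ?addr0 // => l ne_l.
  case: eqP => [mE'|_]; last by rewrite mulr0.
  case/eqP: ne_l; apply: val_inj => /=.
  by rewrite mE' mulmnE mnm1E eqxx mul1n.
rewrite big1 // => l _; case: eqP => [mE|_]; last by rewrite mulr0.
by case/eqP: mN; rewrite mE mulmnE mnm1E eqxx mul1n.
Qed.

End Univariate.

(** * Substituting x_j for the variable t of a generating function *)

Section Substitution.
Variables (n : nat) (R S : comNzRingType) (phi : {rmorphism R -> S}) (j : 'I_n).
Implicit Types F : mps 1 R.

Definition coef1 (A : comNzRingType) (F : mps 1 A) (p : nat) : A :=
  F (U_(ord0) *+ p)%MM.

Lemma mps_uni_coef1 (A : comNzRingType) (F : mps 1 A) :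
  mps_uni ord0 (coef1 F) = F.
Proof.
apply: mpsP => m /=; rewrite /coef1.
suff mE : m = (U_(ord0) *+ m ord0)%MM by rewrite -mE eqxx.
by apply/mnmP => i; rewrite ord1 mulmnE mnm1E eqxx mul1n.
Qed.

Lemma coef1_uni (A : comNzRingType) (a : nat -> A) :
  coef1 (mps_uni ord0 a) =1 a.
Proof.
by move=> p; rewrite /coef1 /= mulmnE mnm1E !eqxx mul1n eqxx.
Qed.

Lemma coef1M_lin (A : comNzRingType) (F : mps 1 A) c p :
  coef1 (F * mps_lin ord0 c) p =
  coef1 F p - if p is q.+1 then coef1 F q * c else 0.
Proof. by rewrite -[in LHS](mps_uni_coef1 F) mps_uniM_lin coef1_uni. Qed.

(* F(t) |-> (phi F)(x_j) *)
Definition mps_subst F : mps n S := mps_uni j (fun p => phi (coef1 F p)).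

Lemma mps_subst1 : mps_subst 1 = 1.
Proof.
rewrite -(mps_uni1 S j); apply: eq_mps_uni => p.
by rewrite -(mps_uni1 R ord0) coef1_uni; case: eqP; rewrite ?rmorph1 ?rmorph0.
Qed.

Lemma mps_substM_lin F c :
  mps_subst (F * mps_lin ord0 c) = mps_subst F * mps_lin j (phi c).
Proof.
rewrite mps_uniM_lin; apply: eq_mps_uni => p; rewrite coef1M_lin rmorphB.
by case: p => [|p]; rewrite ?rmorph0 ?rmorphM.
Qed.

(** Multiplicativity against linear factors suffices to transport the equations that characterise
    the generating functions. *)
Lemma mps_substM_prod F (r : seq nat) (a : nat -> R) :
  mps_subst (F * \prod_(k <- r) mps_lin ord0 (a k)) =
  mps_subst F * \prod_(k <- r) mps_lin j (phi (a k)).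
Proof.
elim: r F => [|k r IHr] F; first by rewrite !big_nil !mulr1.
by rewrite !big_cons !mulrA IHr mps_substM_lin.
Qed.

End Substitution.

Section GeneratingFunction.
Variable S : comNzRingType.
Implicit Types (Z : {freeg S / int}) (a b : nat -> S).

(** Points outside the support have exponent 0. This puts [Z], [Z'] and [Z + Z'] over one common
    list in [hgenD]. *)
Lemma hgen_widen Z (r : seq S) : uniq r -> {subset dom Z <= r} ->
  hgen Z = \prod_(u <- r) mps_lin ord0 u ^ (- coeff u Z).
Proof.
move=> uniq_r sub_r; rewrite [RHS](bigID (mem (dom Z))) /=.
rewrite [X in _ * X]big1 ?mulr1; last first.
  by move=> u /coeff_outdom ->; rewrite oppr0 expr0z.
rewrite -[RHS]big_filter; apply: perm_big; apply: uniq_perm.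
- exact: uniq_dom.
- exact: filter_uniq.
move=> u; rewrite mem_filter andb_idr //; exact: sub_r.
Qed.

Lemma hgenD Z Z' : hgen (Z + Z') = hgen Z * hgen Z'.
Proof.
pose r := undup (dom Z ++ dom Z').
have uniq_r : uniq r by apply: undup_uniq.
rewrite !(@hgen_widen _ r) //.
- rewrite -big_split /=; apply: eq_bigr => u _.
  by rewrite coeffD opprD exprzDr // mps_lin_unit.
- by move=> u uZ; rewrite mem_undup mem_cat uZ orbT.
- by move=> u uZ; rewrite mem_undup mem_cat uZ.
- by move=> u /domD_subset; rewrite mem_undup.
Qed.

Lemma hgen0 : hgen (0 : {freeg S / int}) = 1.
Proof. by rewrite /hgen dom0 big_nil. Qed.

Lemma hgenU (u : S) : hgen << (1 : int) *g u >> * mps_lin ord0 u = 1.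
Proof.
rewrite /hgen domU // big_seq1 coeffU eqxx mulr1 -/(@mps_lin 1 S ord0 u).
by rewrite exprN1 mulVr // mps_lin_unit.
Qed.

Lemma hgenNK Z : hgen (- Z) * hgen Z = 1.
Proof. by rewrite -hgenD addNr hgen0. Qed.

Lemma hgen_psum a p :
  hgen (psum a p%:Z) * \prod_(1 <= k < p.+1) mps_lin ord0 (a k) = 1.
Proof.
rewrite /psum; elim: p => [|p IHp].
  by rewrite !big_geq // hgen0 mulr1.
rewrite !(big_nat_recr p.+1) //= hgenD mulrACA IHp mul1r.
exact: hgenU.
Qed.

(** The generating function of A_p - B_q with its denominator cleared. The factor on the left is a
    unit, so the equation determines the series. *)
Lemma hgen_psumB a b p q :
  hgen (psum a p%:Z - psum b q%:Z) * \prod_(1 <= k < p.+1) mps_lin ord0 (a k)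
  = \prod_(1 <= k < q.+1) mps_lin ord0 (b k).
Proof.
rewrite hgenD mulrAC hgen_psum mul1r -[LHS]mulr1.
by rewrite -[X in _ * X = _](hgen_psum b q) mulrA hgenNK mul1r.
Qed.

Lemma prod_lin_unit n (j : 'I_n) a (r : seq nat) :
  \prod_(k <- r) mps_lin j (a k) \is a GRing.unit.
Proof. by apply: rpred_prod => k _; apply: mps_lin_unit. Qed.

(** At p = 0 the indices are -1 and 0, and both sums are empty. *)
Lemma psum_pred a p : psum a (p%:Z - 1) = psum a p.-1%:Z.
Proof.
case: p => [|p]; last by rewrite intS addrC addKr.
by rewrite sub0r -NegzE /psum big_geq.
Qed.

End GeneratingFunction.

(** * Entries of the two numerators as combinations of powers of x_j *)

Section Plethysm.
Variables (n : nat) (R : comNzRingType).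
Implicit Types (a b : nat -> R) (Z : {freeg R / int}).

Lemma hpl_coef1 (S : comNzRingType) (Z : {freeg S / int}) p :
  hpl Z p%:Z = coef1 (hgen Z) p.
Proof. by []. Qed.

(** The equation of [hgen_psumB] is evaluated at t = x_j and divided by the product of the 1 - a_k
    x_j, which is a unit. *)
Lemma bigG_entry a b p q L (j : 'I_n) :
  mpsX R j ^+ L * (\prod_(1 <= k < q.+1) (1 - mpsC n (b k) * mpsX R j))
    / (\prod_(1 <= k < p.+1) (1 - mpsC n (a k) * mpsX R j)) =
  mps_uni j (fun l => hpl (psum a p%:Z - psum b q%:Z) (l%:Z - L%:Z)).
Proof.
set Z := psum a p%:Z - psum b q%:Z.
rewrite -mpsXn_uni // -mulrA; congr (_ * _).
have eqn := congr1 (@mps_subst n R R idfun j) (hgen_psumB a b p q).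
rewrite mps_substM_prod -[\prod_(_ <= _ < _) _ in RHS]mul1r in eqn.
rewrite mps_substM_prod mps_subst1 mul1r in eqn.
apply: (mulIr (prod_lin_unit j a (index_iota 1 p.+1))).
by rewrite divrK ?prod_lin_unit.
Qed.

(* Both sides are the unique solution of the equation of hgen_psumB. *)
Lemma hpl_map a b p q l :
  hpl (psum (fun k => mpsC n (a k)) p%:Z
       - psum (fun k => mpsC n (b k)) q%:Z) l =
  mpsC n (hpl (psum a p%:Z - psum b q%:Z) l).
Proof.
case: l => l; last by rewrite rmorph0.
rewrite !hpl_coef1; set Z := _ - _; set Z' := psum a _ - _.
suff -> : hgen Z = @mps_subst 1 R (mps n R) (@mpsC n R) ord0 (hgen Z').
  by rewrite coef1_uni.
apply: (mulIr (prod_lin_unit ord0 (fun k => mpsC n (a k)) (index_iota 1 p.+1))).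
rewrite hgen_psumB -mps_substM_prod hgen_psumB.
rewrite -[in RHS](mul1r (\prod_(_ <- _) _)).
by rewrite mps_substM_prod mps_subst1 mul1r.
Qed.

(** Multiplying the series of x_j + Z by 1 - x_j t gives that of Z, whence the recursion
    h_p[x_j + Z] = h_p[Z] + x_j h_{p-1}[x_j + Z], which is then unrolled. *)
Lemma hpl_addX (j : 'I_n) (Z : {freeg (mps n R : comNzRingType) / int})
    (h : int -> R) N L :
  (forall l, hpl Z l = mpsC n (h l)) -> (L < N)%N ->
  hpl (<< (1 : int) *g mpsX R j >> + Z) L%:Z =
  \sum_(l < N) mpsC n (h (L%:Z - l%:Z)) * mpsX R j ^+ l.
Proof.
move=> hE lt_LN; set Z' := _ + Z.
have rec p : coef1 (hgen Z') p =
    coef1 (hgen Z) p + if p is q.+1 then coef1 (hgen Z') q * mpsX R j else 0.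
  have -> : hgen Z = hgen Z' * mps_lin ord0 (mpsX R j).
    by rewrite hgenD mulrAC hgenU mul1r.
  by rewrite coef1M_lin subrK.
have {rec} coefE p : hpl Z' p%:Z =
    \sum_(l < p.+1) mpsC n (h (p%:Z - l%:Z)) * mpsX R j ^+ l.
  rewrite hpl_coef1; elim: p => [|p IHp].
    by rewrite rec addr0 big_ord1 -hpl_coef1 hE mulr1 subr0.
  rewrite rec -hpl_coef1 hE IHp [RHS]big_ord_recl mulr1 subr0; congr (_ + _).
  rewrite mulr_suml; apply: eq_bigr => l _; rewrite -mulrA -exprSr.
  congr (mpsC n (h _) * _).
  by rewrite lift0 !intS opprD addrACA subrr add0r.
(* The sum may be padded up to [N]: for l > L the index L - l is negative. *)
rewrite coefE (big_ord_widen N (fun l => mpsC n (h (L%:Z - l%:Z)) * _ ^+ l)) //.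
rewrite big_mkcond; apply: eq_bigr => l _; case: ltnP => // lt_L.
suff -> : mpsC n (h (L%:Z - l%:Z)) = 0 by rewrite mul0r.
rewrite -hE -(subnKC lt_L) addSnnS PoszD opprD addrA subrr sub0r.
by rewrite -NegzE.
Qed.

End Plethysm.

(** * Expansion in Schur polynomials *)

Section Partitions.
Variables n N : nat.
Implicit Types (g : {ffun 'I_n -> 'I_N}) (mu : part n).

Lemma part_leq mu (i j : 'I_n) : (i <= j)%N -> (mu j <= mu i)%N.
Proof.
move=> le_ij; rewrite /part_nth !(tnth_nth 0%N).
apply: (sorted_leq_nth (leT := geq)) (part_sorted mu) _ _ _ _ le_ij.
- by move=> a b c /= ba cb; apply: leq_trans cb ba.
- exact: leqnn.
- by rewrite inE size_tuple.
- by rewrite inE size_tuple.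
Qed.

(** The usual mu + delta with delta = (n - 1, ..., 0), which turns partitions into strictly
    decreasing sequences. *)
Definition shifted_part mu (i : 'I_n) : nat := (mu i + (n - i.+1))%N.

Lemma decreasing_ffun_gap g (i j : 'I_n) : decreasing_ffun g -> (i <= j)%N ->
  (g j + (j - i) <= g i)%N.
Proof.
move=> decg /subnKC; move: (j - i)%N => k.
elim: k j => [|k IHk] j jE.
  by rewrite addn0; have /val_inj-> : i = j :> nat by rewrite -jE addn0.
have lt_kn : (i + k < n)%N by have := ltn_ord j; lia.
have /= := IHk (Ordinal lt_kn) erefl.
have : (g j < g (Ordinal lt_kn))%N by rewrite decreasing_ffunE //=; lia.
lia.
Qed.

Definition ffun_tuple g : n.-tuple nat := [tuple (g i - (n - i.+1))%N | i < n].

Lemma ffun_tuple_sorted g : decreasing_ffun g -> sorted geq (ffun_tuple g).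
Proof.
move=> decg; apply/(sortedP 0%N) => i; rewrite size_tuple => lt_in.
rewrite -(tnth_nth 0%N _ (Ordinal (ltnW lt_in))).
rewrite -(tnth_nth 0%N _ (Ordinal lt_in)).
rewrite !tnth_mktuple /=.
have := @decreasing_ffun_gap g (Ordinal (ltnW lt_in)) (Ordinal lt_in) decg.
by move=> /(_ (leqnSn i)) /=; lia.
Qed.

Lemma tuple0_sorted : sorted geq [tuple 0%N | i < n].
Proof.
apply/(sortedP 0%N) => i; rewrite size_tuple => lt_in.
rewrite -(tnth_nth 0%N _ (Ordinal (ltnW lt_in))).
rewrite -(tnth_nth 0%N _ (Ordinal lt_in)).
by rewrite !tnth_mktuple.
Qed.

(** Subtracts delta from [g]; the empty partition is the default when the result is not sorted. *)
Definition ffun_part g : part n := insubd (Part tuple0_sorted) (ffun_tuple g).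

Lemma ffun_partK g i : decreasing_ffun g -> shifted_part (ffun_part g) i = g i.
Proof.
move=> decg; rewrite /shifted_part /part_nth /ffun_part.
have -> : part_tuple (insubd (Part tuple0_sorted) (ffun_tuple g)) =
    ffun_tuple g.
  exact: (insubdK (Part tuple0_sorted) (ffun_tuple_sorted decg)).
rewrite tnth_mktuple subnK //.
have lt_in := ltn_ord i.
(* Comparison with the last index gives g i >= n - 1 - i, so the natural subtraction is exact. *)
have lt_pn : (n.-1 < n)%N by lia.
have := decreasing_ffun_gap (i := i) (j := Ordinal lt_pn) decg.
by rewrite /=; lia.
Qed.

(** The partitions with all shifted parts below [N]: the finite range of the Cauchy-Binet sum. *)
Definition box_parts : seq (part n) :=
  [seq ffun_part g | g <- enum (@decreasing_ffun n N)].

Lemma box_parts_uniq : uniq box_parts.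
Proof.
rewrite map_inj_in_uniq ?enum_uniq // => g h.
rewrite !mem_enum => decg dech eq_gh.
by apply/ffunP => i; apply: val_inj; rewrite /= -!ffun_partK // eq_gh.
Qed.

Lemma mem_box_parts mu :
  (forall i, shifted_part mu i < N)%N -> mu \in box_parts.
Proof.
move=> lt_mu; pose g := [ffun i => Ordinal (lt_mu i)].
have decg : decreasing_ffun g.
  apply/forallP => i; apply/forallP => j; apply/implyP => lt_ij.
  rewrite !ffunE /= /shifted_part; have := part_leq mu (ltnW lt_ij).
  by have := ltn_ord j; lia.
apply/mapP; exists g; first by rewrite mem_enum.
apply: val_inj; apply: eq_from_tnth => i.
by have := ffun_partK i decg; rewrite ffunE /= => /addIn/esym.
Qed.

Lemma big_box_parts (S : nmodType) (F : part n -> S) :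
  \sum_(mu <- box_parts) F mu = \sum_(g | decreasing_ffun g) F (ffun_part g).
Proof. by rewrite big_map big_enum. Qed.

End Partitions.

Lemma fsbig_seq_supp (I : choiceType) (S : nmodType) (D : set I) (r : seq I)
    (f : I -> S) : uniq r ->
  (forall i, f i != 0 -> D i /\ i \in r) ->
  \sum_(i \in D) f i = \sum_(i <- r) f i.
Proof.
move=> uniq_r supp; rewrite [RHS]fsbig_seq //.

rewrite (fsbig_widen D setT) //; last first.
  by move=> i [_ nDi]; apply/eqP; apply: contra_notT nDi => /supp [].
rewrite [RHS](fsbig_widen _ setT) // => i [_ nri].
by apply/eqP; apply: contra_notT nri => /supp [].
Qed.

(** * Schur polynomials as quotients of alternants, and their degrees *)

Section Schur.
Variables (n : nat) (R : comNzRingType).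
Implicit Types mu la : part n.

(** The quotient exists by [alternant_quotient] and is unique because the Vandermonde product is
    regular. *)
Lemma schurK mu : schur R mu * vandermonde n R =
  \det (\matrix_(i < n, j < n) mpsX R j ^+ shifted_part mu i).
Proof.
have [q qE] := alternant_quotient (@mpsX n R) (shifted_part mu).
by rewrite qE /schur [\det _]qE mps_exquotP //; apply: lreg_vandermonde.
Qed.

Lemma mps_homog_prod (I : Type) (r : seq I) (F : I -> mps n R) (d : I -> nat) :
  (forall i, mps_homog (d i) (F i)) ->
  mps_homog (\sum_(i <- r) d i) (\prod_(i <- r) F i).
Proof.
move=> hF; elim/big_rec2: _ => [|i F' d' _ hF']; first exact: mps_homog1.
exact: mps_homogM.
Qed.

(** The alternant is homogeneous of degree |mu + delta|, so a monomial of s_mu has degree |mu +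
    delta| - e. This bounds every shifted part. *)
Lemma schur_supp mu e m i :
  mps_homog e (vandermonde n R) -> schur R mu m != 0 ->
  (shifted_part mu i <= mdeg m + e)%N.
Proof.
move=> hV nz_m; suff hs : mps_homog (\sum_i shifted_part mu i)
    (schur R mu * vandermonde n R).
  rewrite (mps_homog_quot (@lreg_vandermonde n R) hV hs nz_m).
  by rewrite (bigD1 i) //= leq_addr.
rewrite schurK /determinant; set d := (X in mps_homog X).
elim/big_rec: _ => [|s F _ hF]; first exact: mps_homog0.
apply: mps_homogD hF.
have hP : mps_homog d
    (\prod_i (\matrix_(i, j) mpsX R j ^+ shifted_part mu i) i (s i)).
  by apply: mps_homog_prod => k; rewrite mxE; apply: mps_homogX.
by rewrite mulr_sign; case: ifP => // _; apply: mps_homogN.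
Qed.

(** Cauchy-Binet for the coefficient matrix times the matrix of powers x_j^l, whose minors are the
    alternants. *)
Lemma det_uni_sum N (a : 'I_n -> nat -> R) :
  \det (\matrix_(i < n, j < n) \sum_(l < N) mpsC n (a i l) * mpsX R j ^+ l) =
  (\sum_(mu <- box_parts n N)
     mpsC n (\det (\matrix_(i < n, j < n) a i (shifted_part mu j))) * schur R mu)
  * vandermonde n R.
Proof.
pose A := \matrix_(i < n, l < N) mpsC n (a i l).
pose B := \matrix_(l < N, j < n) mpsX R j ^+ l.
have -> : \matrix_(i < n, j < n) \sum_(l < N) mpsC n (a i l) * mpsX R j ^+ l =
    A *m B.
  by apply/matrixP => i j; rewrite !mxE; apply: eq_bigr => l _; rewrite !mxE.
rewrite cauchy_binet mulr_suml big_box_parts; apply: eq_bigr => g decg.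
rewrite -mulrA schurK -(det_map_mx (@mpsC n R)).
congr (_ * _); congr determinant.
  by apply/matrixP => i j; rewrite !mxE ffun_partK.
by apply/matrixP => i j; rewrite !mxE ffun_partK.
Qed.

End Schur.

(** * Containment and reindexing for the coefficient determinants *)

Section Coefficients.
Variables (n : nat) (R : comNzRingType) (alpha beta : nat -> R).
Implicit Types la mu : part n.

Lemma hpl_lt0 (S : comNzRingType) (Z : {freeg S / int}) (l : int) :
  (l < 0)%R -> hpl Z l = 0.
Proof. by case: l. Qed.

Lemma part_subPn la mu :
  ~ part_sub la mu -> exists k : 'I_n, (mu k < la k)%N.
Proof.
move=> /asboolPn nsub; apply: contrapT => noex; case/asboolP: nsub => i.
by rewrite leqNgt; apply/negP => lt_i; apply: noex; exists i.
Qed.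

Lemma bigC_sub la mu : bigC alpha beta la mu != 0 -> part_sub la mu.
Proof.
move=> nzC; apply: contrapT => /part_subPn [k lt_k].
(* For j <= k <= i, mu_i <= mu_k < la_k <= la_j, so the index of h is negative. *)
case/eqP: nzC; apply: (det_zero_block (k := k)) => i j le_ki le_jk.
rewrite mxE hpl_lt0 //.
have := part_leq mu le_ki; have := part_leq la le_jk; lia.
Qed.

Lemma smallc_sub la mu : smallc alpha beta la mu != 0 -> part_sub mu la.
Proof.
move=> nzC; apply: contrapT => /part_subPn [k lt_k].
case/eqP: nzC; apply: (det_zero_block (k := k)) => i j le_ki le_jk.
rewrite mxE hpl_lt0 //.
have := part_leq la le_ki; have := part_leq mu le_jk; lia.
Qed.

(** The transpose is taken because [la] indexes the columns of [bigC] but the rows of the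
    numerator. *)
Lemma bigC_shifted la mu : \det (\matrix_(i < n, j < n)
    hpl (psum alpha (la i)%:Z - psum beta i%:Z)
        ((shifted_part mu j)%:Z - (shifted_part la i)%:Z)) =
  bigC alpha beta la mu.
Proof.
rewrite -det_tr; congr (\det _); apply/matrixP => i j; rewrite !mxE.
congr (hpl _ _); rewrite /shifted_part.
have := ltn_ord i; have := ltn_ord j; lia.
Qed.

Lemma smallc_shifted la mu : \det (\matrix_(i < n, j < n)
    hpl (psum beta i%:Z - psum alpha (la i).-1%:Z)
        ((shifted_part la i)%:Z - (shifted_part mu j)%:Z)) =
  smallc alpha beta la mu.
Proof.
congr (\det _); apply/matrixP => i j; rewrite !mxE psum_pred addrC.
congr (hpl _ _); rewrite /shifted_part.
have := ltn_ord i; have := ltn_ord j; lia.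
Qed.

End Coefficients.

Theorem theorem3p2 (R : comNzRingType) (alpha beta : nat -> R) (n : nat)
    (la : part n) :
  mps_has_sum [set mu : part n | part_sub la mu]%classic
    (fun mu => mpsC n (bigC alpha beta la mu) * schur R mu)
    (bigG alpha beta la)
  /\
  smallg alpha beta la =
    \sum_(mu \in [set mu : part n | part_sub mu la]%classic)
      mpsC n (smallc alpha beta la mu) * schur R mu.
Proof.
have [e hV] := mps_homog_vandermonde n R.
split.
  pose D := [set mu : part n | part_sub la mu]%classic.
  pose F mu := mpsC n (bigC alpha beta la mu) * schur R mu.
  (* At a fixed monomial only finitely many mu contribute, and all of them contain [la]. *)
  have supp N m mu : (mdeg m + e < N)%N -> F mu m != 0 ->
      D mu /\ mu \in box_parts n N.
    move=> lt_N; rewrite mpsCM => nzF; split.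
      by apply: (@bigC_sub _ _ alpha beta); apply: contraNneq nzF => ->;
        rewrite mul0r.
    apply: mem_box_parts => i; apply: leq_ltn_trans lt_N.
    apply: (schur_supp i hV); apply: contraNneq nzF => ->.
    by rewrite mulr0.
  pose Q : mps n R := MPS (fun m => \sum_(mu \in D) F mu m).
  suff -> : bigG alpha beta la = Q.
    move=> m; split=> //.
    apply: (@sub_finite_set _ _ [set` box_parts n (mdeg m + e).+1]).
      by move=> mu [_ /= /supp-/(_ _ (ltnSn _)) []].
    exact: finite_seq.
  (* It remains to compare the numerator of G with [Q] times the Vandermonde product. *)
  rewrite -[RHS](mps_exquotP _ (@lreg_vandermonde n R)) /bigG; congr mps_exquot.
  (* With this [N], [box_parts n N] contains every mu that contributes in degree at most
     [mdeg m]. *)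
  apply: mpsP => m; pose N := (mdeg m + e).+1.
  transitivity (((\sum_(mu <- box_parts n N) F mu) * vandermonde n R) m);
    last first.
    apply: (@eqdegM _ _ (mdeg m)) => // k le_k; rewrite mps_sum.
    apply/esym/fsbig_seq_supp; first exact: box_parts_uniq.
    by move=> mu; apply: supp; rewrite ltnS leq_add2r.
  pose a i l :=
    hpl (psum alpha (la i)%:Z - psum beta i%:Z) (l%:Z - (shifted_part la i)%:Z).
  have -> : \sum_(mu <- box_parts n N) F mu = \sum_(mu <- box_parts n N)
      mpsC n (\det (\matrix_(i < n, j < n) a i (shifted_part mu j))) * schur R mu.
    by apply: eq_bigr => mu _; rewrite bigC_shifted.
  rewrite -det_uni_sum.
  (* Cutting each entry at x_j^N is invisible up to degree [mdeg m], which is less than [N]. *)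
  apply: (@eqdeg_det _ _ (mdeg m)) (leqnn _) => i j; rewrite !mxE bigG_entry.
  by apply: mps_uni_trunc; rewrite ltnS leq_addr.
(* This exceeds every shifted part of [la], hence those of every mu contained in [la]. *)
pose N := (\sum_i shifted_part la i).+1.
rewrite (@fsbig_seq_supp _ _ _ (box_parts n N)); last 2 first.
- exact: box_parts_uniq.
- move=> mu nzF; have sub_mu : part_sub mu la.
    apply: (@smallc_sub _ _ alpha beta); apply: contraNneq nzF => ->.
    by rewrite rmorph0 mul0r.
  split=> //; apply: mem_box_parts => i; rewrite ltnS (bigD1 i) //=.
  by rewrite (leq_trans _ (leq_addr _ _)) // leq_add2r sub_mu.
under eq_bigr do rewrite -smallc_shifted.
rewrite -[RHS](mps_exquotP _ (@lreg_vandermonde n R)).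
rewrite -(det_uni_sum N (fun i l =>
  hpl (psum beta i%:Z - psum alpha (la i).-1%:Z) ((shifted_part la i)%:Z - l%:Z))).
congr mps_exquot; congr determinant; apply/matrixP => i j; rewrite !mxE.
(* The argument becomes x_j + (B - A), where the h_l[B - A] are constants. *)
rewrite psum_pred -addrA [- _ + _]addrC.
apply: hpl_addX; first exact: hpl_map.
by rewrite ltnS (bigD1 i) //= leq_addr.
Qed.
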